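(* Let $I$ be an interval of $\mathbb{R}$, let $n\in\mathbb{N}$, let $A: I\to\mathbb{C}^{n\times n}$ and $\bm{f}: I\to\mathbb{C}^n$ be continuous, and let $R: I\to\mathbb{C}^{n\times n}$ be continuously differentiable with $R(t)$ invertible for all $t\in I$. Put $J(t):=\left(R'(t)+R(t)A(t)\right)R^{-1}(t)$ for $t\in I$. Suppose that $\|R(t)\|$ and $\|R^{-1}(t)\|$ are bounded on $I$. Then the equation $\bm{x}'=A(t)\bm{x}+\bm{f}(t)$ is Ulam stable on $I$ if and only if the equation $\bm{y}'=J(t)\bm{y}$ is Ulam stable on $I$.
   Context: Fix a norm $\|\cdot\|$ on $\mathbb{C}^n$; for matrices $M\in\mathbb{C}^{n\times n}$, $\|M\|$ denotes the induced matrix norm. For continuous $B: I\to\mathbb{C}^{n\times n}$ and $\bm{g}: I\to\mathbb{C}^n$, the equation $\bm{x}'=B(t)\bm{x}+\bm{g}(t)$ is called Ulam stable on $I$ if there is a constant $K>0$ such that: for every $\varepsilon>0$ and every continuously differentiable $\bm{\phi}: I\to\mathbb{C}^n$ with $\sup_{t\in I}\|\bm{\phi}'(t)-B(t)\bm{\phi}(t)-\bm{g}(t)\|\le\varepsilon$, there exists a solution $\bm{x}: I\to\mathbb{C}^n$ of $\bm{x}'=B(t)\bm{x}+\bm{g}(t)$ with $\sup_{t\in I}\|\bm{\phi}(t)-\bm{x}(t)\|\le K\varepsilon$. The homogeneous case is $\bm{g}\equiv\bm{0}$. *)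

(* Defs.v *)
From HB Require Import structures.
From mathcomp Require Import all_boot all_order all_algebra.
From mathcomp Require Import all_classical all_reals all_analysis.
From mathcomp Require Import complex.

Set Implicit Arguments.
Unset Strict Implicit.
Unset Printing Implicit Defensive.

Import Order.TTheory GRing.Theory Num.Theory.
Import numFieldNormedType.Exports.

Local Open Scope classical_set_scope.
Local Open Scope ring_scope.
Local Open Scope complex_scope.

(* The complex numbers, packed as a numFieldType so that they inherit the
   topology that the library puts on every numFieldType (R[i] on its own has
   no canonical topology). *)
Definition Cplx (R : realType) : numFieldType := R[i].

(* Functions on an interval I are total functions on R of which only the
   values on I matter. C^n and C^(n x n) carry the library topology of
   matrices (entrywise convergence), which is the topology of every norm on
   them. *)

(* A norm on C^n. The modulus `|a| lives in R[i]; Re recovers it in R. *)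
Definition is_vnorm (R : realType) (n : nat) (N : 'cV[Cplx R]_n -> R) : Prop :=
  [/\ forall x, 0 <= N x,
      forall x, N x = 0 -> x = 0,
      forall (a : Cplx R) x, N (a *: x) = complex.Re `|a| * N x &
      forall x y, N (x + y) <= N x + N y].

(* Induced matrix norm. The supremum is taken in the extended reals, so that
   no finiteness proof is needed for the definition to be meaningful. *)
Definition mxnorm (R : realType) (n : nat) (N : 'cV[Cplx R]_n -> R)
    (M : 'M[Cplx R]_n) : \bar R :=
  ereal_sup [set (N (M *m x))%:E | x in [set x | N x <= 1]].

Definition mxnorm_bounded_on (R : realType) (n : nat)
    (N : 'cV[Cplx R]_n -> R) (I : set R) (M : R -> 'M[Cplx R]_n) : Prop :=
  exists c : R, forall t, I t -> (mxnorm N (M t) <= c%:E)%E.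

(* l is the derivative at t of f : I -> C^(m x k): the increments h are real
   and restricted to t + h in I, hence one-sided derivatives at those
   endpoints of I that belong to I. *)
Definition has_deriv_on (R : realType) (m k : nat) (I : set R)
    (f : R -> 'M[Cplx R]_(m, k)) (t : R) (l : 'M[Cplx R]_(m, k)) : Prop :=
  (fun h : R => ((h^-1)%:C : Cplx R) *: (f (t + h) - f t))
    @ within [set h | I (t + h)] 0^' --> l.

(* f is continuously differentiable on I, with derivative f'. *)
Definition C1_on (R : realType) (m k : nat) (I : set R)
    (f f' : R -> 'M[Cplx R]_(m, k)) : Prop :=
  (forall t, I t -> has_deriv_on I f t (f' t)) /\ {within I, continuous f'}.

Definition is_solution (R : realType) (n : nat) (I : set R)
    (B : R -> 'M[Cplx R]_n) (g x : R -> 'cV[Cplx R]_n) : Prop :=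
  forall t, I t -> has_deriv_on I x t (B t *m x t + g t).

Definition supnorm_on (R : realType) (n : nat) (N : 'cV[Cplx R]_n -> R)
    (I : set R) (u : R -> 'cV[Cplx R]_n) : \bar R :=
  ereal_sup [set (N (u t))%:E | t in I].

(* Ulam stability on I of x' = B(t) x + g(t). *)
Definition ulam_stable (R : realType) (n : nat) (N : 'cV[Cplx R]_n -> R)
    (I : set R) (B : R -> 'M[Cplx R]_n) (g : R -> 'cV[Cplx R]_n) : Prop :=
  exists2 K : R, 0 < K &
    forall eps : R, 0 < eps ->
    forall phi phi' : R -> 'cV[Cplx R]_n, C1_on I phi phi' ->
      (supnorm_on N I (fun t => phi' t - B t *m phi t - g t)%R <= eps%:E)%E ->
      exists2 x : R -> 'cV[Cplx R]_n, is_solution I B g x &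
        (supnorm_on N I (fun t => phi t - x t)%R <= (K * eps)%:E)%E.

(* Main.v *)
(** If [x0] solves [x' = A x + f] on [I], then [x |-> Q (x - x0)] maps solutions
    of [x' = A x + f] to solutions of [y' = J y] and multiplies the defect of a
    C^1 function by [Q]; its inverse is of the same affine form. Since [Q] and
    [Q^-1] are bounded, Ulam stability passes from either equation to the other.
    The substance is the existence of [x0], which no hypothesis provides: as [I]
    need not be closed and [A] may be unbounded on it, Picard iteration is run
    on all of [I] at once, in a weighted norm whose weight is built from an
    antiderivative of a continuous bound for [A] and [f]. *)

Require Import Defs.
From HB Require Import structures.
From mathcomp Require Import all_boot all_order all_algebra.
From mathcomp Require Import all_classical all_reals all_analysis.
From mathcomp Require Import complex.
From mathcomp Require Import ring lra.

Set Implicit Arguments.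
Unset Strict Implicit.
Unset Printing Implicit Defensive.

Import Order.TTheory GRing.Theory Num.Theory.
Import numFieldNormedType.Exports.

Local Open Scope classical_set_scope.
Local Open Scope ring_scope.
Local Open Scope complex_scope.

(** * Derivatives of real functions along a set *)

Definition increments (R : realType) (I : set R) (t : R) : set_system R :=
  within [set h | I (t + h)] 0^'.

(** Only [Filter], not [ProperFilter]: at an isolated point [t] of [I] this filter contains the
    empty set. *)
Instance increments_filter (R : realType) (I : set R) (t : R) :
  Filter (increments I t).
Proof. exact: within_filter. Qed.

(** Real counterpart of [has_deriv_on]. Integration, the mean value argument and Picard iteration
    are done for real functions; complex vectors are treated through real and imaginary parts. *)
Definition rderiv (R : realType) (I : set R) (f : R -> R) (t l : R) : Prop :=
  h^-1 * (f (t + h) - f t) @[h --> increments I t] --> l.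

(** The left filter keeps the point [t] and the right one deletes it; this makes no difference
    because the limit is the value [f t] itself. *)
Lemma cvg_within_increments {R : realType} {T : topologicalType} {I : set R}
    {f : R -> T} {t : R} :
  f s @[s --> within I (nbhs t)] --> f t <->
  f (t + h) @[h --> increments I t] --> f t.
Proof.
split=> ft P Pft.
- have /(nbhs0P (fun s => I s -> P (f s))) := ft P Pft.
  by rewrite /= /increments /within /dnbhs /=; apply: filterS => h Ph _ /Ph.
- have ftP : \forall h \near (0 : R), h != 0 -> I (t + h) -> P (f (t + h)).
    exact: ft P Pft.
  apply/(nbhs0P (fun s => I s -> P (f s))); apply: filterS ftP => h Ph Ih.
  have [h0|/Ph/(_ Ih)//] := eqVneq h 0.
  by rewrite h0 addr0; exact: nbhs_singleton.
Qed.

Lemma increments_id_cvg (R : realType) (I : set R) (t : R) :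
  h @[h --> increments I t] --> (0 : R).
Proof. by apply: cvg_within_filter; exact: nbhs_dnbhs. Qed.

Lemma increments_neq0 (R : realType) (I : set R) (t : R) :
  \forall h \near increments I t, h != 0.
Proof.
have H : \forall h \near (0 : R), h != 0 -> I (t + h) -> h != 0.
  by apply: filterE => h.
exact: H.
Qed.

Lemma rderiv_continuous (R : realType) (I : set R) (f : R -> R) (t l : R) :
  rderiv I f t l -> f s @[s --> within I (nbhs t)] --> f t.
Proof.
move=> fl; apply/cvg_within_increments.
have : f t + h * (h^-1 * (f (t + h) - f t)) @[h --> increments I t]
    --> f t + 0 * l.
  by apply: cvgD; [exact: cvg_cst|apply: cvgM => //; exact: increments_id_cvg].
rewrite mul0r addr0; apply: cvg_trans; apply: near_eq_cvg.
near=> h; have h0 : h != 0 by near: h; exact: increments_neq0.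
by rewrite mulrA divff// mul1r addrC subrK.
Unshelve. all: by end_near. Qed.

Lemma rderivD (R : realType) (I : set R) (f g : R -> R) (t k l : R) :
  rderiv I f t k -> rderiv I g t l -> rderiv I (fun s => f s + g s) t (k + l).
Proof.
move=> fk gl; rewrite /rderiv.
by under eq_fun do rewrite opprD addrACA mulrDr; exact: cvgD.
Qed.

Lemma rderivZ (R : realType) (I : set R) (f : R -> R) (t k c : R) :
  rderiv I f t k -> rderiv I (fun s => c * f s) t (c * k).
Proof.
move=> fk; rewrite /rderiv.
by under eq_fun do rewrite -mulrBr mulrCA; apply: cvgM => //; exact: cvg_cst.
Qed.

Lemma rderivB (R : realType) (I : set R) (f g : R -> R) (t k l : R) :
  rderiv I f t k -> rderiv I g t l -> rderiv I (fun s => f s - g s) t (k - l).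
Proof.
move=> fk /(@rderivZ _ _ _ _ _ (-1)); rewrite mulN1r => /(rderivD fk).
by under eq_fun do rewrite mulN1r.
Qed.

Lemma segment_subset (R : realType) (I : set R) (a b : R) :
  is_interval I -> I a -> I b -> `[a, b] `<=` I.
Proof. by move=> itvI Ia Ib x /=; rewrite in_itv /=; exact: itvI. Qed.

(** The mean value theorem on [[s, t]]: it asks for a two-sided derivative in the interior and for
    mere continuity at the ends. *)
Lemma rderiv_nondecreasing (R : realType) (I : set R) (f f' : R -> R) :
  is_interval I -> (forall t, I t -> rderiv I f t (f' t)) ->
  (forall t, I t -> 0 <= f' t) ->
  forall s t, I s -> I t -> s <= t -> f s <= f t.
Proof.
move=> itvI df f'0 s t Is It st; have stI := segment_subset itvI Is It.
have df_in x : x \in `]s, t[ -> is_derive x (1 : R) f (f' x).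
  rewrite in_itv/= => /andP[sx xt].
  have Ix : I x by apply: stI; rewrite /= in_itv/= !ltW.
  (* Around an interior point small increments stay in [I], so the restricted derivative is the
     ordinary one. *)
  have dfx : h^-1 *: (f (h *: (1 : R) + x) - f x) @[h --> (0 : R)^'] --> f' x.
    rewrite /GRing.scale/=.
    under eq_fun do rewrite mulr1 (addrC _ x).
    move=> P /(df _ Ix) dfP.
    have {}dfP : \forall h \near (0 : R)^',
        I (x + h) -> P (h^-1 * (f (x + h) - f x)) by exact: dfP.
    have h_small : \forall h \near (0 : R)^', `|h| < Num.min (x - s) (t - x).
      by apply: dnbhs0_lt; rewrite lt_min !subr_gt0 sx.
    apply: filterS2 h_small dfP => h; rewrite lt_min !ltr_norml => hst; apply.
    by apply: stI; rewrite /= in_itv/=; lra.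
  apply: DeriveDef; first by apply/cvg_ex; exists (f' x).
  exact: cvg_lim dfx.
have cf : {within `[s, t], continuous f}.
  apply: (continuous_subspaceW stI).
  by apply/subspace_continuousP => x Ix; exact: rderiv_continuous (df _ Ix).
have [c cst eqf] := MVT_segment st df_in cf.
by rewrite -subr_ge0 eqf mulr_ge0 ?subr_ge0// f'0//; exact: stI.
Qed.

(** Both [v - u] and [v + u] have nonnegative derivative, hence are nondecreasing. The absolute
    value around [v t - v s] makes the bound symmetric in [s] and [t], so one estimate serves both
    sides of a base point. *)
Lemma rderiv_mean_value (R : realType) (I : set R) (u u' v v' : R -> R) :
  is_interval I ->
  (forall t, I t -> rderiv I u t (u' t)) ->
  (forall t, I t -> rderiv I v t (v' t)) ->
  (forall t, I t -> `|u' t| <= v' t) ->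
  forall s t, I s -> I t -> `|u t - u s| <= `|v t - v s|.
Proof.
move=> itvI du dv uv s t Is It; wlog st : s t Is It / s <= t.
  move=> H; have [/H|/ltW /H] := leP s t; first exact.
  by rewrite distrC (distrC (v t)); exact.
have le_sub : v s - u s <= v t - u t.
  apply: (rderiv_nondecreasing itvI (fun r Ir => rderivB (dv r Ir) (du r Ir)))
    => // r /uv; rewrite ler_norml; lra.
have le_add : v s + u s <= v t + u t.
  apply: (rderiv_nondecreasing itvI (fun r Ir => rderivD (dv r Ir) (du r Ir)))
    => // r /uv; rewrite ler_norml; lra.
by rewrite [leRHS]ger0_norm ?ler_norml; lra.
Qed.

(** * Antiderivatives of continuous functions *)

Lemma Rintegral_segment_ge (R : realType) (g : R -> R) (a b : R) :
  b <= a -> \int[lebesgue_measure]_(x in `[a, b]) g x = 0.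
Proof.
rewrite le_eqVlt => /predU1P[->|ba]; first by rewrite set_itv1 Rintegral_set1.
by rewrite set_itv_ge ?Rintegral_set0// bnd_simp -ltNge.
Qed.

Lemma Rintegral_segmentD (R : realType) (g : R -> R) (a b c : R) :
  a <= b -> b <= c -> {within `[a, c], continuous g} ->
  \int[lebesgue_measure]_(x in `[a, c]) g x =
  \int[lebesgue_measure]_(x in `[a, b]) g x +
  \int[lebesgue_measure]_(x in `[b, c]) g x.
Proof.
move=> ab bc cg.
have ig : lebesgue_measure.-integrable `[a, c] (EFin \o g).
  by apply: continuous_compact_integrable => //; exact: segment_compact.
rewrite -(Rintegral_itv_obnd_cbnd (r := b)); last first.
  by apply: integrableS ig => //; apply: subset_itv; rewrite bnd_simp.
have := @Rintegral_itvB _ g (BLeft a) (BRight c) b ig.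
rewrite !bnd_simp => /(_ ab bc) <-; ring.
Qed.

(** Integrates [|g - c| <= e]. With [c] the value of [g] at an endpoint, this bounds the error of
    the difference quotient of an integral. *)
Lemma Rintegral_segment_dist (R : realType) (g : R -> R) (a b c e : R) :
  a <= b -> {within `[a, b], continuous g} ->
  (forall x, a <= x <= b -> `|g x - c| <= e) ->
  `|\int[lebesgue_measure]_(x in `[a, b]) g x - c * (b - a)| <= e * (b - a).
Proof.
move=> ab cg gce.
have integrable_ab h : {within `[a, b], continuous h} ->
    lebesgue_measure.-integrable `[a, b] (EFin \o h).
  by move=> ch; apply: continuous_compact_integrable => //; exact: segment_compact.
have integral_cst k :
    \int[lebesgue_measure]_(x in `[a, b]) k = k * (b - a) :> R.
  rewrite Rintegral_cst//= lebesgue_measure_itv/= lte_fin.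
  case: ltP => //= ba; rewrite (@le_anti _ _ a b) ?ab ?ba//.
  by rewrite subrr.
have ccst k : {within `[a, b], continuous (fun=> k : R)}.
  by apply: continuous_subspaceT => x; exact: cvg_cst.
have cgc : {within `[a, b], continuous (fun x => g x - c)}.
  by move=> x; apply: cvgB; [exact: cg|exact: cvg_cst].
rewrite -integral_cst -RintegralB//; [|exact: integrable_ab..].
apply: le_trans (le_normr_Rintegral _ _) _ => //; first exact: integrable_ab.
rewrite -integral_cst; apply: le_Rintegral => //.
- apply: (integrable_ab (fun x => `|g x - c|)) => x.
  by apply: cvg_norm; exact: cgc.
- exact: integrable_ab.
Qed.

Lemma antiderivative_exists (R : realType) (I : set R) (g : R -> R) :
  is_interval I -> {within I, continuous g} ->
  exists G : R -> R, forall t, I t -> rderiv I G t (g t).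
Proof.
move=> itvI cg; have [[t0 It0]|I0] := pselect (I !=set0); last first.
  by exists (fun=> 0) => t It; exfalso; apply: I0; exists t.
pose int a b := \int[lebesgue_measure]_(x in `[a, b]) g x.
(* The signed integral from [t0] to [t]: an integral over a reversed segment is [0], so at most one
   term survives. [GB] then splits on the position of [t0] relative to [s <= t]. *)
pose G t := int t0 t - int t t0.
have cg_seg a b : I a -> I b -> {within `[a, b], continuous g}.
  by move=> Ia Ib; exact: continuous_subspaceW (segment_subset itvI Ia Ib) cg.
have GB s t : I s -> I t -> s <= t -> G t - G s = int s t.
  move=> Is It st; rewrite /G.
  have [t0s|st0] := leP t0 s.
    rewrite /int (Rintegral_segment_ge _ t0s).
    rewrite (Rintegral_segment_ge _ (le_trans t0s st)).
    rewrite (Rintegral_segmentD t0s st); [ring|exact: cg_seg].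
  have [t0t|tt0] := leP t0 t.
    rewrite /int (Rintegral_segment_ge _ t0t) (Rintegral_segment_ge _ (ltW st0)).
    rewrite (Rintegral_segmentD (ltW st0) t0t); [ring|exact: cg_seg].
  rewrite /int (Rintegral_segment_ge _ (ltW tt0)) (Rintegral_segment_ge _ (ltW st0)).
  rewrite (Rintegral_segmentD st (ltW tt0)); [ring|exact: cg_seg].
exists G => t It; apply/cvgrPdist_le => e e0.
have /subspace_continuousP/(_ t It)/cvgrPdist_le/(_ _ e0) := cg.
move=> /(@nbhs_ballP _ _ t)[d /= d0 dP].
have {}dP s : I s -> `|s - t| < d -> `|g s - g t| <= e.
  by move=> Is st; rewrite distrC; apply: dP => //; rewrite /ball/= distrC.
have h_small : \forall h \near (0 : R)^', `|h| < d by exact: dnbhs0_lt.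
have h_neq0 : \forall h \near (0 : R)^', h != 0 by exact: nbhs_dnbhs_neq.
have P : \forall h \near (0 : R)^', I (t + h) ->
    `|g t - h^-1 * (G (t + h) - G t)| <= e; last exact: P.
apply: filterS2 h_small h_neq0 => h hd h0 Ith.
have -> : g t - h^-1 * (G (t + h) - G t) = - (h^-1 * (G (t + h) - G t - g t * h)).
  by field.
rewrite normrN normrM normfV ler_pdivrMl ?normr_gt0// [leRHS]mulrC.
(* For [h < 0] the segment of integration is [[t + h, t]], of length [- h], and the increment of [G]
   changes sign. *)
case: (ltgtP h 0) h0 => // [hlt0|hgt0] _.
- have GN : G (t + h) - G t - g t * h = - (int (t + h) t - g t * - h).
    by rewrite -GB ?gerDl ?(ltW hlt0)//; ring.
  rewrite GN normrN (ltr0_norm hlt0).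
  have := @Rintegral_segment_dist R g (t + h) t (g t) e.
  rewrite opprD addrA subrr add0r; apply.
  + by rewrite gerDl ltW.
  + exact: cg_seg.
  + move=> x xt; apply: dP; first exact: itvI xt.
    by move: hd; rewrite !ltr_norml; lra.
- rewrite GB ?lerDl ?(ltW hgt0)//.
  have := @Rintegral_segment_dist R g t (t + h) (g t) e.
  rewrite addrAC subrr add0r (gtr0_norm hgt0); apply.
  + by rewrite lerDl ltW.
  + exact: cg_seg.
  + move=> x xt; apply: dP; first exact: itvI xt.
    by move: hd; rewrite !ltr_norml; lra.
Qed.

(** Carathéodory's form of the chain rule: the slope of [F], completed by [k] at [f t], is
    continuous there, and factoring through it avoids dividing by [f (t + h) - f t], which may
    vanish. *)
Lemma rderiv_comp (R : realType) (I : set R) (f F : R -> R) (t l k : R) :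
  rderiv I f t l -> is_derive (f t) (1 : R) F k ->
  rderiv I (fun s => F (f s)) t (k * l).
Proof.
move=> fl dF; have [dFt DFt] := dF.
pose slope y := if y == f t then k else (F y - F (f t)) / (y - f t).
have slope_ft : slope (f t) = k by rewrite /slope eqxx.
have slope_cont : slope y @[y --> f t] --> slope (f t).
  apply/continuous_withinNshiftx; rewrite slope_ft -DFt.
  have : h^-1 *: ((F \o shift (f t)) (h *: (1 : R)) - F (f t)) @[h --> (0 : R)^']
    --> 'D_1 F (f t) by exact: dFt.
  apply: cvg_trans; apply: near_eq_cvg; near=> h.
  have h0 : h != 0 by near: h; exact: nbhs_dnbhs_neq.
  rewrite /= /slope -subr_eq0 addrK (negPf h0) /GRing.scale/= mulr1.
  by rewrite mulrC.
have fshift : f (t + h) @[h --> increments I t] --> f t.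
  exact/cvg_within_increments/(rderiv_continuous fl).
rewrite /rderiv [X in X @ _](_ : _ =
  (fun h => slope (f (t + h)) * (h^-1 * (f (t + h) - f t)))).
  by rewrite -slope_ft; apply: cvgM => //; exact: cvg_comp fshift slope_cont.
apply/funext => h; rewrite /slope; case: eqVneq => [->|fh].
  by rewrite !subrr !mulr0.
by rewrite mulrCA divfK// subr_eq0.
Unshelve. all: by end_near. Qed.

Lemma rderiv_cst (R : realType) (I : set R) (c t : R) :
  rderiv I (fun=> c) t 0.
Proof.
rewrite /rderiv; under eq_fun do rewrite subrr mulr0.
exact: cvg_cst.
Qed.

Lemma cvg_sumr {K : numFieldType} {V : normedModType K} (J : Type) (r : seq J)
    (P : pred J) (T : Type) (F : set_system T) {FF : Filter F}
    (f : J -> T -> V) (l : J -> V) :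
  (forall i, P i -> f i x @[x --> F] --> l i) ->
  \sum_(i <- r | P i) f i x @[x --> F] --> \sum_(i <- r | P i) l i.
Proof. by move=> fl; apply: cvg_big => //; exact: add_continuous. Qed.

(** For [M > 0], take an integer [k] above [M / e] and use [k < 2^k]. *)
Lemma geometric_small (R : realType) (M e : R) :
  0 < e -> exists k, 2^-1 ^+ k * M <= e.
Proof.
move=> e0; have [M0|M0] := leP M 0.
  by exists 0%N; rewrite expr0 mul1r (le_trans M0)// ltW.
have Me : 0 <= M / e by rewrite divr_ge0// ltW.
exists (Num.bound (M / e)); rewrite exprVn mulrC ler_pdivrMr ?exprn_gt0//.
rewrite mulrC -ler_pdivrMr//; apply: ltW; apply: lt_trans (archi_boundP Me) _.
by rewrite -natrX ltr_nat ltn_expl.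
Qed.

(* The weight [E = exp C + exp (- C)], where [C' = c], dominates the odd function
   [S = exp C - exp (- C)], whose derivative is [c E]: this replaces the
   exponential weight in both time directions at once. *)
Lemma weight_exists (R : realType) (I : set R) (c : R -> R) (t0 : R) :
  is_interval I -> {within I, continuous c} -> 
  exists E S : R -> R, [/\ forall t, 1 <= E t, forall t, `|S t| <= E t,
    S t0 = 0, {within I, continuous E} &
    forall t, I t -> rderiv I S t (c t * E t)].
Proof.
move=> itvI cc; have [C0 dC0] := antiderivative_exists itvI cc.
pose C t := C0 t - C0 t0.
have dC t : I t -> rderiv I C t (c t).
  by move=> It; rewrite -[c t]subr0; apply: rderivB; [exact: dC0|exact: rderiv_cst].
have dexpC t : I t -> rderiv I (fun s => expR (C s)) t (expR (C t) * c t).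
  by move=> It; apply: rderiv_comp; exact: dC.
have dexpNC t : I t -> rderiv I (fun s => expR (- C s)) t (expR (- C t) * - c t).
  move=> It; apply: (@rderiv_comp _ _ (fun s => - C s)).
  by have := rderivZ (c := -1) (dC t It); rewrite mulN1r; under eq_fun do rewrite mulN1r.
exists (fun t => expR (C t) + expR (- C t)), (fun t => expR (C t) - expR (- C t)).
split => [t|t|||t It].
- have := expR_ge1Dx (C t); have := expR_ge1Dx (- C t); lra.
- have := expR_gt0 (C t); have := expR_gt0 (- C t); rewrite ler_norml; lra.
- by rewrite /C subrr oppr0 subrr.
- apply/subspace_continuousP => t It.
  exact: rderiv_continuous (rderivD (dexpC t It) (dexpNC t It)).
- rewrite [c t * _](_ : _ = expR (C t) * c t - expR (- C t) * - c t); last ring.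
  by apply: rderivB; [exact: dexpC|exact: dexpNC].
Qed.

(** * Global existence for Lipschitz systems *)

(* [x k] is a Cauchy sequence with geometric rate; the supremum of its lower
   barriers [x k - 2^(1-k) w] is its limit. *)
Lemma geometric_limit (R : realType) (x : R ^nat) (w : R) :
  (forall k, `|x k.+1 - x k| <= 2^-1 ^+ k * w) ->
  exists l, forall k, `|l - x k| <= 2 * (2^-1 ^+ k * w).
Proof.
move=> dx; pose q k : R := 2^-1 ^+ k * w.
have qS k : q k = 2 * q k.+1 by rewrite /q exprS mulrA mulrA divff ?mul1r.
pose u k := x k - 2 * q k; pose v k := x k + 2 * q k.
have u_nd : nondecreasing_seq u.
  by apply/nondecreasing_seqP => k; have := dx k; rewrite -/(q k) /u qS ler_norml; lra.
have v_ni : nonincreasing_seq v.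
  by apply/nonincreasing_seqP => k; have := dx k; rewrite -/(q k) /v qS ler_norml; lra.
have uv k m : u k <= v m.
  apply: le_trans (u_nd _ _ (leq_maxl k m)) _.
  apply: le_trans _ (v_ni _ _ (leq_maxr k m)).
  have := dx (maxn k m); rewrite -/(q _) /u /v.
  by move=> /(le_trans (normr_ge0 _)); lra.
exists (sup (range u)) => k; rewrite ler_distl -/(q k) -/(u k) -/(v k).
apply/andP; split.
  by apply: ub_le_sup; [exists (v 0%N) => _ [m _ <-]|exists k].
by apply: ge_sup; [exists (u 0%N), 0%N|move=> _ [m _ <-]].
Qed.

(** Successive approximations from [0]. Relative to the weight [E], each step halves the distance
    between iterates on all of [I], whatever the growth of [a]. The finite type [T] indexes the
    coordinates. *)
Lemma picard_exists (R : realType) (T : finType) (I : set R) (t0 : R)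
    (F : R -> (T -> R) -> T -> R) (a : R -> R) :
  is_interval I -> I t0 -> {within I, continuous a} ->
  (forall t, I t -> 0 <= a t) ->
  (forall y : R -> T -> R, (forall j, {within I, continuous (y^~ j)}) ->
    forall j, {within I, continuous (fun t => F t (y t) j)}) ->
  (forall t x y d, I t -> (forall j, `|x j - y j| <= d) ->
    forall j, `|F t x j - F t y j| <= a t * d) ->
  exists y : R -> T -> R, forall t j, I t -> rderiv I (y^~ j) t (F t (y t) j).
Proof.
move=> itvI It0 ca a0 cF lipF.
(* [AD] selects the antiderivative vanishing at [t0]; its value on functions not continuous on [I]
   is arbitrary. *)
have [AD ADP] : {AD : (R -> R) -> R -> R & forall g, {within I, continuous g} ->
    AD g t0 = 0 /\ forall t, I t -> rderiv I (AD g) t (g t)}.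
  apply: (@choice _ _ (fun g G => {within I, continuous g} ->
    G t0 = 0 /\ forall t, I t -> rderiv I G t (g t))) => g.
  have [cg|ncg] := pselect {within I, continuous g}; last by exists g => /ncg.
  have [G dG] := antiderivative_exists itvI cg.
  exists (fun t => G t - G t0) => _; split => [|t It]; first by rewrite subrr.
  by rewrite -[g t]subr0; apply: rderivB; [exact: dG|exact: rderiv_cst].
pose b t := \sum_j `|F t (fun=> 0) j|.
have cb : {within I, continuous b}.
  move=> t; apply: cvg_sumr => j _; apply: cvg_norm.
  by apply: cF => i; apply: continuous_subspaceT => s; exact: cvg_cst.
(* The term [2 * a] yields the contraction factor [1/2]; the term [b] controls the first iterate,
   whose derivative is [F] at the zero vector. *)
pose c t := 2 * a t + b t.
have cc : {within I, continuous c}.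
  by move=> t; apply: cvgD; [apply: cvgM; [exact: cvg_cst|exact: ca]|exact: cb].
have b0 t : 0 <= b t by apply: sumr_ge0.
have [E [S [E1 SE St0 cE dS]]] := weight_exists t0 itvI cc.
(* Compare [u] with [q * S]: both vanish at [t0], and the derivative of the latter is [q * (c * E)];
   then use [|S| <= E]. *)
have weight_le q u u' : 0 <= q -> u t0 = 0 ->
    (forall t, I t -> rderiv I u t (u' t)) ->
    (forall t, I t -> `|u' t| <= q * (c t * E t)) ->
    forall t, I t -> `|u t| <= q * E t.
  move=> q0 u0 du u'E t It.
  have := rderiv_mean_value itvI du
    (fun s Is => rderivZ (c := q) (dS s Is)) u'E It0 It.
  rewrite u0 St0 mulr0 !subr0 => /le_trans; apply.
  by rewrite normrM (ger0_norm q0) ler_wpM2l.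
have AD_le q g h : 0 <= q -> {within I, continuous g} ->
    {within I, continuous h} ->
    (forall t, I t -> `|g t - h t| <= q * (c t * E t)) ->
    forall t, I t -> `|AD g t - AD h t| <= q * E t.
  move=> q0 /ADP[g0 dg] /ADP[h0 dh].
  apply: (weight_le q (fun t => AD g t - AD h t)) => //.
    by rewrite g0 h0 subrr.
  by move=> s Is; apply: rderivB; [exact: dg|exact: dh].
pose x := fix x k : R -> T -> R :=
  if k is k'.+1 then fun t j => AD (fun s => F s (x k' s) j) t else fun=> fun=> 0.
have cx k j : {within I, continuous (x k)^~ j}.
  elim: k j => [|k IHk] j /=.
    by apply: continuous_subspaceT => s; exact: cvg_cst.
  apply/subspace_continuousP => t It.
  by apply: rderiv_continuous; apply: (ADP _ _).2 => //; exact: cF.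
pose h : R := 2^-1.
have h0 : 0 <= h by rewrite invr_ge0.
have hk0 k : 0 <= h ^+ k by exact: exprn_ge0.
have hS k : 2 * h ^+ k.+1 = h ^+ k by rewrite exprS mulrA divff ?mul1r.
have E0 t : 0 <= E t by exact: le_trans (E1 t).
(* The factor [2] in the hypothesis is absorbed by [2 * a <= c]; integrating the conclusion with
   [AD_le] returns [q * E], half of the initial bound. *)
have lip_weight q t y z j : I t -> 0 <= q ->
    (forall i, `|y i - z i| <= 2 * q * E t) ->
    `|F t y j - F t z j| <= q * (c t * E t).
  move=> It q0 yz; apply: le_trans (lipF _ _ _ _ It yz j) _.
  rewrite /c mulrA (mulrC q) -mulrA -subr_ge0.
  rewrite [X in 0 <= X](_ : _ = b t * (q * E t)); last by ring.
  by rewrite !mulr_ge0.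
have dx k t j : I t -> `|x k.+1 t j - x k t j| <= h ^+ k * E t.
  elim: k t j => [|k IHk] t j It.
    rewrite /= subr0 expr0 mul1r.
    have [AD0 dAD] := ADP _ (cF _ (cx 0%N) j).
    rewrite -[E t]mul1r; apply: (weight_le 1 _ _ _ AD0 dAD) => // s Is.
    rewrite mul1r; apply: (@le_trans _ _ (b s)).
      by rewrite /b (bigD1 j)//= lerDl sumr_ge0.
    have := ler_wpM2l (b0 s) (E1 s); rewrite mulr1 => /le_trans; apply.
    by rewrite ler_wpM2r// lerDr mulr_ge0// a0.
  rewrite -[x k.+2 t j]/(AD (fun s => F s (x k.+1 s) j) t).
  rewrite -[x k.+1 t j]/(AD (fun s => F s (x k s) j) t).
  apply: AD_le => //; [by apply: cF => i; exact: cx..|move=> s Is].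
  apply: lip_weight => // i; by rewrite hS; exact: IHk.
have [y yP] : {y : R -> T -> R & forall t, I t -> forall j k, 
    `|y t j - x k t j| <= 2 * (h ^+ k * E t)}.
  apply: (@choice _ _ (fun t yt => I t -> forall j k, 
    `|yt j - x k t j| <= 2 * (h ^+ k * E t))) => t.
  have [It|nIt] := pselect (I t); last by exists (fun=> 0) => /nIt.
  have [yt ytP] : {yt : T -> R & forall j k,
      `|yt j - x k t j| <= 2 * (h ^+ k * E t)}; last by exists yt.
  apply: (@choice _ _ (fun j l => forall k,
      `|l - x k t j| <= 2 * (h ^+ k * E t))) => j.
  by apply: geometric_limit => k; exact: dx.
have cy j : {within I, continuous y^~ j}.
  apply/subspace_continuousP => t It; apply/cvgrPdist_le => e e0.
  (* Convergence is uniform only relative to [E], but [E s <= E t + 1] near [t]. The tails at [t]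
     and [s] then add up to at most [2 * h ^+ k * (2 * E t + 1)], which the factor [4] makes at most
     [e / 2]. *)
  have [k kP] := geometric_small (4 * (2 * E t + 1)) e0.
  have : \forall s \near within I (nbhs t), `|E t - E s| <= 1.
    have /subspace_continuousP/(_ t It)/cvgrPdist_le := cE; exact.
  have : \forall s \near within I (nbhs t), `|x k t j - x k s j| <= e / 2.
    have /subspace_continuousP/(_ t It)/cvgrPdist_le := cx k j.
    by apply; rewrite divr_gt0.
  have : \forall s \near within I (nbhs t), I s by exact: withinT.
  apply: filterS3 => s Is xts Ets.
  have := yP t It j k; have := yP s Is j k.
  move: kP xts Ets; rewrite -/(h ^+ k) /from_subspace.
  move: (h ^+ k) (hk0 k) => p p0 /=; rewrite !ler_norml => kP xts Ets yxs yxt.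
  have : p * E s <= p * (E t + 1) by rewrite ler_wpM2l//; lra.
  lra.
(* Fixed point: both sides are within [h ^+ k * E t] of the iterate [x k.+1], hence within
   [2 * h ^+ k * E t] of each other, for every [k]. *)
have yz t j : I t -> AD (fun s => F s (y s) j) t = y t j.
  move=> It; apply/eqP; rewrite -subr_eq0 -normr_le0; apply/ler_addgt0Pr => e e0.
  rewrite add0r; have [k kP] := geometric_small (2 * E t) e0.
  apply: le_trans _ kP; rewrite -(subrK (x k.+1 t j) (AD _ _)) -addrA.
  apply: le_trans (ler_normD _ _) _; rewrite (distrC _ (y t j)).
  have := yP t It j k.+1; rewrite mulrA hS.
  have : `|AD (fun s => F s (y s) j) t - x k.+1 t j| <= h ^+ k * E t.
    rewrite -[x k.+1 t j]/(AD (fun s => F s (x k s) j) t).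
    apply: AD_le => //; [by apply: cF => i; exact: cy|
                         by apply: cF => i; exact: cx|move=> s Is].
    by apply: lip_weight => // i; rewrite -mulrA; exact: yP.
  rewrite -/h; lra.
(* The witness is the integral side, whose derivative [ADP] provides directly; it agrees with [y] on
   [I]. *)
exists (fun t j => AD (fun s => F s (y s) j) t) => t j It.
rewrite (_ : (fun i => _) = y t); last by apply/funext => i; exact: yz.
by apply: (ADP _ _).2 => //; exact: cF.
Qed.

(** * Limits of matrices and of complex numbers *)

Lemma cvg_mx {T : topologicalType} (m n : nat) (U : Type) (F : set_system U)
    {FF : Filter F} (f : U -> 'M[T]_(m, n)) (M : 'M[T]_(m, n)) :
  (forall i j, f x i j @[x --> F] --> M i j) -> f x @[x --> F] --> M.
Proof.
move=> fM A [P MP PA].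
have : \forall x \near F, forall i j, P i j (f x i j).
  apply: filter_forall => i; apply: filter_forall => j; exact: fM.
by apply: filterS => x Px; exact: PA.
Qed.

Lemma cvg_mx_coord {K : numFieldType} (m n : nat) (U : Type) (F : set_system U)
    {FF : Filter F} (f : U -> 'M[K]_(m, n)) (M : 'M[K]_(m, n)) i j :
  f x @[x --> F] --> M -> f x i j @[x --> F] --> M i j.
Proof. by move=> fM; exact: (cvg_comp _ _ fM (@coord_continuous K m n i j M)). Qed.

Lemma cvg_mulmx {K : numFieldType} (m n p : nat) (U : Type) (F : set_system U)
    {FF : Filter F} (f : U -> 'M[K]_(m, n)) (g : U -> 'M[K]_(n, p))
    (M : 'M[K]_(m, n)) (N : 'M[K]_(n, p)) :
  f x @[x --> F] --> M -> g x @[x --> F] --> N ->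
  f x *m g x @[x --> F] --> M *m N.
Proof.
move=> fM gN; apply: cvg_mx => i j; rewrite mxE.
under eq_fun do rewrite mxE.
by apply: (cvg_sumr (V := K^o)) => k _; apply: cvgM; exact: cvg_mx_coord.
Qed.

Lemma cvg_det {K : numFieldType} (n : nat) (U : Type) (F : set_system U)
    {FF : Filter F} (f : U -> 'M[K]_n) (M : 'M[K]_n) :
  f x @[x --> F] --> M -> \det (f x) @[x --> F] --> \det M.
Proof.
move=> fM; apply: (cvg_sumr (V := K^o)) => s _; apply: cvgM; first exact: cvg_cst.
apply: cvg_big; first exact: mul_continuous.
by move=> i _; exact: cvg_mx_coord.
Qed.

(** Cramer's formula: the inverse is the adjugate divided by the determinant, and both are
    polynomial in the entries. *)
Lemma cvg_invmx {K : numFieldType} (n : nat) (U : Type) (F : set_system U)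
    {FF : Filter F} (f : U -> 'M[K]_n) (M : 'M[K]_n) :
  M \in unitmx -> f x @[x --> F] --> M -> invmx (f x) @[x --> F] --> invmx M.
Proof.
move=> uM fM.
have detf : \det (f x) @[x --> F] --> \det M by exact: cvg_det.
have detM : \det M != 0 by rewrite -unitfE -unitmxE.
have : (\det (f x))^-1 *: \adj (f x) @[x --> F] --> (\det M)^-1 *: \adj M.
  apply: cvg_mx => i j; rewrite !mxE; under eq_fun do rewrite !mxE.
  apply: cvgM; first exact: cvgV.
  rewrite /cofactor. apply: cvgM; first exact: cvg_cst.
  apply: cvg_det.
  apply: cvg_mx => k l; rewrite !mxE; under eq_fun do rewrite !mxE.
  exact: cvg_mx_coord.
(* [invmx] returns its argument on singular matrices, so the formula holds only eventually, once the
   determinant of [f x] is nonzero. *)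
rewrite {2}/invmx uM; apply: cvg_trans; apply: near_eq_cvg; near=> x.
have detfx : \det (f x) != 0 by near: x; exact: (cvgr_neq0 _ detf).
by rewrite /invmx unitmxE unitfE detfx.
Unshelve. all: by end_near. Qed.

Lemma cvg_Re (R : realType) (U : Type) (F : set_system U) {FF : Filter F}
    (f : U -> Cplx R) (l : Cplx R) :
  f x @[x --> F] --> l -> complex.Re (f x) @[x --> F] --> complex.Re l.
Proof.
move=> /cvgrPdist_lt fl; apply/cvgrPdist_lt => e e0.
have := fl (e%:C) _; rewrite ltcR => /(_ e0); apply: filterS => x.
rewrite -raddfB -ltcR => /(le_lt_trans _); apply; exact: normc_ge_Re.
Qed.

Lemma cvg_scalel {K : numFieldType} (U : Type) (F : set_system U)
    {FF : Filter F} (f : U -> K) (c a : K) :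
  f x @[x --> F] --> a -> c * f x @[x --> F] --> c * a.
Proof. by move=> fa; apply: cvgM => //; exact: cvg_cst. Qed.

Lemma cvg_axpy {K : numFieldType} (U : Type) (F : set_system U)
    {FF : Filter F} (f g : U -> K) (c a b : K) :
  f x @[x --> F] --> a -> g x @[x --> F] --> b ->
  f x + c * g x @[x --> F] --> a + c * b.
Proof. by move=> fa gb; apply: cvgD => //; exact: cvg_scalel. Qed.

Lemma cvg_Complex (R : realType) (U : Type) (F : set_system U) {FF : Filter F}
    (f g : U -> R) (a b : R) :
  f x @[x --> F] --> a -> g x @[x --> F] --> b ->
  (Complex (f x) (g x) : Cplx R) @[x --> F] --> (Complex a b : Cplx R).
Proof.
pose ofR (r : R) : Cplx R := r%:C; pose I : Cplx R := 'i%C.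
have cvg_ofR (u : U -> R) (c : R) :
    u x @[x --> F] --> c -> ofR (u x) @[x --> F] --> ofR c.
  move=> /cvgrPdist_lt uc; apply/cvgrPdist_lt => e.
  (* A positive [e] for the order of the complex numbers is real, so its real part can serve as the
     tolerance. *)
  rewrite ltcE /= => /andP[/eqP ime e0].
  apply: filterS (uc _ e0) => x ucx.
  rewrite -(raddfB (real_complex R)) normc_def /= expr0n addr0 sqrtr_sqr.
  by rewrite ltcE /= ime eqxx.
have ComplexE r s : (Complex r s : Cplx R) = ofR r + I * ofR s.
  exact: (complexE (Complex r s)).
move=> /cvg_ofR fa /cvg_ofR gb.
rewrite ComplexE [X in X @ _](_ : _ = fun x => ofR (f x) + I * ofR (g x)).
  exact: cvg_axpy.
by apply/funext => x; exact: ComplexE.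
Qed.

Lemma cvg_Im (R : realType) (U : Type) (F : set_system U) {FF : Filter F}
    (f : U -> Cplx R) (l : Cplx R) :
  f x @[x --> F] --> l -> complex.Im (f x) @[x --> F] --> complex.Im l.
Proof.
have ImE (z : Cplx R) : complex.Im z = complex.Re (- 'i%C * z).
  by case: z => a b; rewrite /= oppr0 mul0r sub0r mulN1r opprK.
move=> fl; rewrite ImE; under eq_fun do rewrite ImE.
by apply: cvg_Re; exact: cvg_scalel.
Qed.

(** * Derivatives of complex matrices *)

Section difference_quotients.
Context {K : numFieldType} {U : Type} {F : set_system U} {FF : Filter F}.
(** In use, [c h] is the inverse increment and [F] the filter [increments I t]; the rules below only
    need the algebra of the quotients. *)
Variable c : U -> K.

Lemma cvg_quotientD (m k : nat) (f g : U -> 'M[K]_(m, k))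
    (f0 g0 df dg : 'M[K]_(m, k)) :
  c h *: (f h - f0) @[h --> F] --> df -> c h *: (g h - g0) @[h --> F] --> dg ->
  c h *: (f h + g h - (f0 + g0)) @[h --> F] --> df + dg.
Proof.
move=> fdf gdg; rewrite [X in X @ _](_ : _ = fun h : U =>
    c h *: (f h - f0) + c h *: (g h - g0)); first exact: cvgD.
by apply/funext => h; rewrite -scalerDr addrACA -opprD.
Qed.

Lemma cvg_quotientN (m k : nat) (f : U -> 'M[K]_(m, k))
    (f0 df : 'M[K]_(m, k)) :
  c h *: (f h - f0) @[h --> F] --> df ->
  c h *: (- f h - - f0) @[h --> F] --> - df.
Proof.
move=> fdf; rewrite [X in X @ _](_ : _ = fun h : U => - (c h *: (f h - f0))).
  exact: cvgN.
by apply/funext => h; rewrite -scalerN opprD.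
Qed.

(** From [f g - f0 g0 = (f - f0) g + f0 (g - g0)], the factors being kept in order. *)
Lemma cvg_quotientM (m k p : nat) (f : U -> 'M[K]_(m, k))
    (g : U -> 'M[K]_(k, p)) (f0 df : 'M[K]_(m, k)) (g0 dg : 'M[K]_(k, p)) :
  g h @[h --> F] --> g0 ->
  c h *: (f h - f0) @[h --> F] --> df -> c h *: (g h - g0) @[h --> F] --> dg ->
  c h *: (f h *m g h - f0 *m g0) @[h --> F] --> df *m g0 + f0 *m dg.
Proof.
move=> gg0 fdf gdg; rewrite [X in X @ _](_ : _ = fun h : U =>
    (c h *: (f h - f0)) *m g h + f0 *m (c h *: (g h - g0))).
  by apply: cvgD; apply: cvg_mulmx => //; exact: cvg_cst.
apply/funext => h; rewrite -scalemxAl -scalemxAr -scalerDr; congr (_ *: _).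
by rewrite mulmxBl mulmxBr addrA subrK.
Qed.

(** From [f^-1 - f0^-1 = - f^-1 (f - f0) f0^-1] and the continuity of inversion. *)
Lemma cvg_quotient_invmx (n : nat) (f : U -> 'M[K]_n) (f0 df : 'M[K]_n) :
  f0 \in unitmx -> (\forall h \near F, f h \in unitmx) ->
  f h @[h --> F] --> f0 -> c h *: (f h - f0) @[h --> F] --> df ->
  c h *: (invmx (f h) - invmx f0) @[h --> F] -->
    - (invmx f0 *m df *m invmx f0).
Proof.
move=> uf0 uf ff0 fdf.
have : - (invmx (f h) *m (c h *: (f h - f0)) *m invmx f0) @[h --> F] -->
    - (invmx f0 *m df *m invmx f0).
  apply: cvgN; apply: cvg_mulmx; last exact: cvg_cst.
  by apply: cvg_mulmx => //; exact: cvg_invmx.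
apply: cvg_trans; apply: near_eq_cvg; near=> h.
have ufh : f h \in unitmx by near: h.
rewrite -scalemxAr -scalemxAl -scalerN; congr (_ *: _).
rewrite mulmxBr mulVmx// mulmxBl mul1mx -mulmxA mulmxV// mulmx1.
by rewrite opprB.
Unshelve. all: by end_near. Qed.

End difference_quotients.

Lemma has_deriv_on_cvg (R : realType) (m k : nat) (I : set R)
    (f : R -> 'M[Cplx R]_(m, k)) t l :
  has_deriv_on I f t l -> f (t + h) @[h --> increments I t] --> f t.
Proof.
move=> fl; have cC : ((h%:C : Cplx R)) @[h --> increments I t] --> (0 : Cplx R).
  by apply: cvg_Complex; [exact: increments_id_cvg|exact: cvg_cst].
have : f t + (h%:C : Cplx R) *: (((h^-1)%:C : Cplx R) *: (f (t + h) - f t))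
    @[h --> increments I t] --> f t + (0 : Cplx R) *: l.
  by apply: cvgD; [exact: cvg_cst|exact: cvgZ].
rewrite scale0r addr0; apply: cvg_trans; apply: near_eq_cvg; near=> h.
have h0 : h != 0 by near: h; exact: increments_neq0.
rewrite scalerA [X in X *: _](_ : _ = 1) ?scale1r ?subrKC//.
by rewrite -[LHS](rmorphM (real_complex R)) divff.
Unshelve. all: by end_near. Qed.

Lemma has_deriv_on_continuous (R : realType) (m k : nat) (I : set R)
    (f f' : R -> 'M[Cplx R]_(m, k)) :
  (forall t, I t -> has_deriv_on I f t (f' t)) -> {within I, continuous f}.
Proof.
move=> df; apply/subspace_continuousP => t It.
exact/cvg_within_increments/has_deriv_on_cvg/df.
Qed.

Lemma has_deriv_onD (R : realType) (m k : nat) (I : set R)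
    (f g : R -> 'M[Cplx R]_(m, k)) t l l' :
  has_deriv_on I f t l -> has_deriv_on I g t l' ->
  has_deriv_on I (fun s => f s + g s) t (l + l').
Proof. exact: cvg_quotientD. Qed.

Lemma has_deriv_onN (R : realType) (m k : nat) (I : set R)
    (f : R -> 'M[Cplx R]_(m, k)) t l :
  has_deriv_on I f t l -> has_deriv_on I (fun s => - f s) t (- l).
Proof. exact: cvg_quotientN. Qed.

Lemma has_deriv_onM (R : realType) (m k p : nat) (I : set R)
    (f : R -> 'M[Cplx R]_(m, k)) (g : R -> 'M[Cplx R]_(k, p)) t l l' :
  has_deriv_on I f t l -> has_deriv_on I g t l' ->
  has_deriv_on I (fun s => f s *m g s) t (l *m g t + f t *m l').
Proof.
by move=> fl gl; exact: (cvg_quotientM (has_deriv_on_cvg gl) fl gl).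
Qed.

Lemma has_deriv_on_invmx (R : realType) (n : nat) (I : set R)
    (Q : R -> 'M[Cplx R]_n) t l :
  (forall s, I s -> Q s \in unitmx) -> I t -> has_deriv_on I Q t l ->
  has_deriv_on I (fun s => invmx (Q s)) t (- (invmx (Q t) *m l *m invmx (Q t))).
Proof.
move=> uQ It Ql.
have uQt : \forall h \near increments I t, Q (t + h) \in unitmx.
  have : \forall h \near increments I t, I (t + h) by exact: withinT.
  by apply: filterS => h /uQ.
exact: (cvg_quotient_invmx (uQ t It) uQt (has_deriv_on_cvg Ql) Ql).
Qed.

(** The increments are real, so the quotient acts separately on real and imaginary parts. *)
Lemma has_deriv_on_Complex (R : realType) (m k : nat) (I : set R)
    (u v : R -> 'I_m -> 'I_k -> R) (u' v' : 'I_m -> 'I_k -> R) t :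
  (forall i j, rderiv I (fun s => u s i j) t (u' i j)) ->
  (forall i j, rderiv I (fun s => v s i j) t (v' i j)) ->
  has_deriv_on I (fun s => \matrix_(i, j) (Complex (u s i j) (v s i j) : Cplx R))
    t (\matrix_(i, j) (Complex (u' i j) (v' i j) : Cplx R)).
Proof.
move=> du dv; apply: cvg_mx => i j; rewrite mxE.
rewrite [X in X @ _](_ : _ = fun h => Complex
  (h^-1 * (u (t + h) i j - u t i j)) (h^-1 * (v (t + h) i j - v t i j)) : Cplx R).
  exact: cvg_Complex (du i j) (dv i j).
apply/funext => h; rewrite !mxE.
by apply/eqP; rewrite eq_complex /= !mul0r subr0 addr0 !eqxx.
Qed.

(** * Linear systems *)

Lemma mulmx_affine_coordB (K : pzRingType) (n : nat) (A : 'M[K]_n)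
    (x y f : 'cV[K]_n) i :
  (A *m x + f) i ord0 - (A *m y + f) i ord0 =
  \sum_j A i j * (x - y) j ord0.
Proof.
rewrite !mxE opprD addrACA subrr addr0 -sumrB.
by apply: eq_bigr => j _; rewrite !mxE mulrBr.
Qed.

(** Each of the two parts of a product [z w] is at most [(|Re z| + |Im z|) d]. This gives the
    Lipschitz constant of a complex linear map for the sup norm of its real coordinates. *)
Lemma norm_Re_Im_sum_mul (R : realType) (n : nat) (z w : 'I_n -> Cplx R) d :
  (forall j, `|complex.Re (w j)| <= d) -> (forall j, `|complex.Im (w j)| <= d) ->
  let s := \sum_j z j * w j in
  let m := (\sum_j (`|complex.Re (z j)| + `|complex.Im (z j)|)) * d in
  `|complex.Re s| <= m /\ `|complex.Im s| <= m.
Proof.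
move=> Rew Imw; rewrite /= mulr_suml.
apply: (big_ind2 (fun (s : Cplx R) m => `|complex.Re s| <= m /\ `|complex.Im s| <= m)).
- by rewrite /= normr0.
- move=> [a b] m [a' b'] m' /= [am bm] [am' bm'].
  by split; apply: le_trans (ler_normD _ _) _; exact: lerD.
- move=> j _; move: (z j) (w j) (Rew j) (Imw j) => [a b] [a' b'] /= a'd b'd.
  have ad c : `|c * a'| <= `|c| * d by rewrite normrM ler_wpM2l.
  have bd c : `|c * b'| <= `|c| * d by rewrite normrM ler_wpM2l.
  rewrite mulrDl; split; first by apply: le_trans (ler_normB _ _) _; exact: lerD.
  by apply: le_trans (ler_normD _ _) _; exact: lerD.
Qed.

(** The complex system is a real one with coordinates in ['I_n * bool], where [false] marks the real
    part and [true] the imaginary part. *)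
Lemma linear_solution_exists (R : realType) (n : nat) (I : set R)
    (A : R -> 'M[Cplx R]_n) (f : R -> 'cV[Cplx R]_n) :
  is_interval I -> {within I, continuous A} -> {within I, continuous f} ->
  exists x : R -> 'cV[Cplx R]_n, is_solution I A f x.
Proof.
move=> itvI cA cf; have [[t0 It0]|I0] := pselect (I !=set0); last first.
  by exists (fun=> 0) => t It; exfalso; apply: I0; exists t.
pose vec (y : 'I_n * bool -> R) : 'cV[Cplx R]_n :=
  \matrix_(i, j) (Complex (y (i, false)) (y (i, true)) : Cplx R).
pose part (b : bool) (z : Cplx R) := if b then complex.Im z else complex.Re z.
pose F t y (k : 'I_n * bool) := part k.2 ((A t *m vec y + f t) k.1 ord0).
(* Summing over all rows gives one continuous Lipschitz constant that dominates that of each row. *)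
pose a t : R := \sum_i \sum_j (`|complex.Re (A t i j)| + `|complex.Im (A t i j)|).
have cvg_part b (U : Type) (G : set_system U) (FG : Filter G)
    (g : U -> Cplx R) (l : Cplx R) :
    g x @[x --> G] --> l -> part b (g x) @[x --> G] --> part b l.
  by case: b; [exact: cvg_Im|exact: cvg_Re].
have ca : {within I, continuous a}.
  apply/subspace_continuousP => t It.
  have cAt : A s @[s --> within I (nbhs t)] --> A t.
    by have /subspace_continuousP := cA; exact.
  apply: cvg_sumr => i _; apply: cvg_sumr => j _.
  have cAij : A s i j @[s --> within I (nbhs t)] --> A t i j.
    exact: cvg_mx_coord.
  by apply: cvgD; apply: cvg_norm; [exact: cvg_Re|exact: cvg_Im].
have a0 t : I t -> 0 <= a t.
  by move=> _; apply: sumr_ge0 => i _; apply: sumr_ge0 => j _; exact: addr_ge0.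
have cF (y : R -> 'I_n * bool -> R) :
    (forall k, {within I, continuous y^~ k}) ->
    forall k, {within I, continuous fun t => F t (y t) k}.
  move=> cy k; apply/subspace_continuousP => t It.
  have cyt i : y s i @[s --> within I (nbhs t)] --> y t i.
    by have /subspace_continuousP := cy i; exact.
  have cAt : A s @[s --> within I (nbhs t)] --> A t.
    by have /subspace_continuousP := cA; exact.
  have cft : f s @[s --> within I (nbhs t)] --> f t.
    by have /subspace_continuousP := cf; exact.
  have cvec : vec (y s) @[s --> within I (nbhs t)] --> vec (y t).
    apply: cvg_mx => i j; rewrite mxE; under eq_fun do rewrite mxE.
    exact: cvg_Complex.
  apply: cvg_part; apply: cvg_mx_coord.
  exact: (cvgD (cvg_mulmx cAt cvec) cft).
have lipF t x y d : I t -> (forall k, `|x k - y k| <= d) ->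
    forall k, `|F t x k - F t y k| <= a t * d.
  move=> It xy [i b]; rewrite /F /=.
  have partB (u v : Cplx R) : part b u - part b v = part b (u - v).
    by case: u v => [? ?] [? ?]; case: b.
  rewrite partB mulmx_affine_coordB.
  have d_Re j : `|complex.Re ((vec x - vec y) j ord0)| <= d by rewrite !mxE; exact: xy.
  have d_Im j : `|complex.Im ((vec x - vec y) j ord0)| <= d by rewrite !mxE; exact: xy.
  have [Re_le Im_le] := norm_Re_Im_sum_mul (fun j => A t i j) d_Re d_Im.
  apply: le_trans (_ : _ <= (\sum_j (`|complex.Re (A t i j)| + `|complex.Im (A t i j)|)) * d) _.
    by case: b {partB}.
  have d0 : 0 <= d by exact: le_trans (xy (i, b)).
  rewrite ler_wpM2r// /a [leRHS](bigD1 i)//= lerDl.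
  by apply: sumr_ge0 => k _; apply: sumr_ge0 => j _; exact: addr_ge0.
have [y yP] := picard_exists itvI It0 ca a0 cF lipF.
exists (fun t => vec (y t)) => t It.
have := @has_deriv_on_Complex R n 1 I (fun s i _ => y s (i, false))
  (fun s i _ => y s (i, true)) (fun i _ => F t (y t) (i, false))
  (fun i _ => F t (y t) (i, true)) t (fun i _ => yP t (i, false) It)
  (fun i _ => yP t (i, true) It).
rewrite [X in has_deriv_on _ _ _ X](_ : _ = A t *m vec (y t) + f t) //.
apply/matrixP => i j; rewrite mxE (ord1 j) /F /part /=.
by case: ((A t *m vec (y t) + f t) i ord0).
Qed.

(** * Ulam stability under affine changes of variables *)

(** The hypotheses say that [y = P x + p] carries [x' = B1 x + g1] to [y' = B2 y + g2]; the left
    side of the conclusion is the derivative of [P x + p] along a solution. *)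
Lemma gauge_solution_eq (K : pzRingType) (n : nat) (P P' B1 B2 : 'M[K]_n)
    (p p' g1 g2 x : 'cV[K]_n) :
  P' + P *m B1 = B2 *m P -> P *m g1 + p' - B2 *m p = g2 ->
  P' *m x + P *m (B1 *m x + g1) + p' = B2 *m (P *m x + p) + g2.
Proof.
move=> PB <-; rewrite !mulmxDr !mulmxA -PB mulmxDl.
by rewrite [in RHS](addrC _ (- _)) !addrA addrK.
Qed.

(** The left side is the defect of [P^-1 (y - p)] in the first equation, its derivative being
    expanded by the product and inverse rules. *)
Lemma gauge_defect_eq (K : comUnitRingType) (n : nat) (P P' B1 B2 : 'M[K]_n)
    (p p' g1 g2 y y' : 'cV[K]_n) :
  P \in unitmx ->
  P' + P *m B1 = B2 *m P -> P *m g1 + p' - B2 *m p = g2 ->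
  - (invmx P *m P' *m invmx P) *m (y - p) + invmx P *m (y' - p')
    - B1 *m (invmx P *m (y - p)) - g1 = invmx P *m (y' - B2 *m y - g2).
Proof.
move=> uP PB <-.
(* Writing [g1] and [B1] with [invmx P] in front lets this factor be pulled out of the whole left
   side. *)
have -> : g1 = invmx P *m (P *m g1) by rewrite mulmxA mulVmx// mul1mx.
have -> : B1 = invmx P *m (B2 *m P - P').
  by rewrite -PB addrAC subrr add0r mulmxA mulVmx// mul1mx.
rewrite [P *m (_ *m _)]mulmxA mulmxV// mul1mx.
move: (P *m g1) => Pg.
have -> : invmx P *m (B2 *m P - P') *m (invmx P *m (y - p)) =
    invmx P *m (B2 *m (y - p) - P' *m (invmx P *m (y - p))).
  by rewrite -!mulmxA mulmxBl -(mulmxA B2) (mulmxA P) mulmxV// mul1mx.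
rewrite mulNmx -!mulmxA -mulmxN -!mulmxDr -!mulmxBr; congr (_ *m _).
move: (P' *m _) => D; rewrite mulmxBr.
move: (B2 *m y) (B2 *m p) => u v.
apply/colP => i; rewrite !mxE; ring.
Qed.

(** * Calculus of continuous and C^1 matrix functions on a set *)

Lemma within_continuous_mulmx {K : numFieldType} {T : topologicalType}
    (m n p : nat) (I : set T) (f : T -> 'M[K]_(m, n)) (g : T -> 'M[K]_(n, p)) :
  {within I, continuous f} -> {within I, continuous g} ->
  {within I, continuous (fun t => f t *m g t)}.
Proof. by move=> cf cg t; apply: cvg_mulmx; [exact: cf|exact: cg]. Qed.

Lemma within_continuousD {K : numFieldType} {V : normedModType K}
    {T : topologicalType} (I : set T) (f g : T -> V) :
  {within I, continuous f} -> {within I, continuous g} ->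
  {within I, continuous (fun t => f t + g t)}.
Proof. by move=> cf cg t; apply: cvgD; [exact: cf|exact: cg]. Qed.

Lemma within_continuousN {K : numFieldType} {V : normedModType K}
    {T : topologicalType} (I : set T) (f : T -> V) :
  {within I, continuous f} -> {within I, continuous (fun t => - f t)}.
Proof. by move=> cf t; apply: cvgN; exact: cf. Qed.

Lemma within_continuous_invmx {K : numFieldType} {T : topologicalType} (n : nat)
    (I : set T) (f : T -> 'M[K]_n) :
  (forall t, I t -> f t \in unitmx) ->
  {within I, continuous f} -> {within I, continuous (fun t => invmx (f t))}.
Proof.
move=> uf /subspace_continuousP cf; apply/subspace_continuousP => t It.
by apply: cvg_invmx; [exact: uf|exact: cf].
Qed.

Lemma C1_on_continuous (R : realType) (m k : nat) (I : set R)
    (f f' : R -> 'M[Cplx R]_(m, k)) :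
  C1_on I f f' -> {within I, continuous f}.
Proof. by case=> df _; exact: has_deriv_on_continuous df. Qed.

Lemma C1_onD (R : realType) (m k : nat) (I : set R)
    (f f' g g' : R -> 'M[Cplx R]_(m, k)) :
  C1_on I f f' -> C1_on I g g' ->
  C1_on I (fun t => f t + g t) (fun t => f' t + g' t).
Proof.
move=> [df cf'] [dg cg']; split; last exact: (within_continuousD cf' cg').
by move=> t It; exact: (has_deriv_onD (df t It) (dg t It)).
Qed.

Lemma C1_onN (R : realType) (m k : nat) (I : set R)
    (f f' : R -> 'M[Cplx R]_(m, k)) :
  C1_on I f f' -> C1_on I (fun t => - f t) (fun t => - f' t).
Proof.
move=> [df cf']; split; last exact: (within_continuousN cf').
by move=> t It; exact: (has_deriv_onN (df t It)).
Qed.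

Lemma C1_onM (R : realType) (m k p : nat) (I : set R)
    (f f' : R -> 'M[Cplx R]_(m, k)) (g g' : R -> 'M[Cplx R]_(k, p)) :
  C1_on I f f' -> C1_on I g g' ->
  C1_on I (fun t => f t *m g t) (fun t => f' t *m g t + f t *m g' t).
Proof.
move=> C1f C1g; have cf := C1_on_continuous C1f; have cg := C1_on_continuous C1g.
move: C1f C1g => [df cf'] [dg cg']; split.
  by move=> t It; exact: (has_deriv_onM (df t It) (dg t It)).
exact: (within_continuousD (within_continuous_mulmx cf' cg)
                           (within_continuous_mulmx cf cg')).
Qed.

Lemma C1_on_invmx (R : realType) (n : nat) (I : set R) (Q Q' : R -> 'M[Cplx R]_n) :
  (forall t, I t -> Q t \in unitmx) -> C1_on I Q Q' ->
  C1_on I (fun t => invmx (Q t)) (fun t => - (invmx (Q t) *m Q' t *m invmx (Q t))).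
Proof.
move=> uQ C1Q; have cQ := C1_on_continuous C1Q.
have cV := within_continuous_invmx uQ cQ.
move: C1Q => [dQ cQ']; split.
  by move=> t It; exact: (has_deriv_on_invmx uQ It (dQ t It)).
exact: (within_continuousN (within_continuous_mulmx
  (within_continuous_mulmx cV cQ') cV)).
Qed.

(** By homogeneity: scale [x] to norm [1], unless [N x = 0], where [x] itself is zero. *)
Lemma mxnorm_le (R : realType) (n : nat) (N : 'cV[Cplx R]_n -> R)
    (M : 'M[Cplx R]_n) (c : R) x :
  is_vnorm N -> (mxnorm N M <= c%:E)%E -> N (M *m x) <= c * N x.
Proof.
move=> [N_ge0 N_eq0 NZ _] Mc.
have N0 : N 0 = 0.
  by have := NZ 0 0; rewrite scale0r normr0 mul0r.
have [Nx0|Nx0] := eqVneq (N x) 0.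
  by rewrite (N_eq0 _ Nx0) mulmx0 N0 mulr0.
have Nx_gt0 : 0 < N x by rewrite lt_def Nx0 N_ge0.
pose a : Cplx R := ((N x)^-1)%:C.
have Na z : N (a *: z) = (N x)^-1 * N z.
  rewrite NZ normc_def /= expr0n addr0 sqrtr_sqr ger0_norm//.
  by rewrite invr_ge0 ltW.
have : ((N (M *m (a *: x)))%:E <= c%:E)%E.
  apply: le_trans Mc; apply: ereal_sup_ubound; exists (a *: x) => //=.
  by rewrite Na mulVf.
by rewrite lee_fin -scalemxAr Na ler_pdivrMl// mulrC.
Qed.

Lemma supnorm_on_leP (R : realType) (n : nat) (N : 'cV[Cplx R]_n -> R)
    (I : set R) (u : R -> 'cV[Cplx R]_n) (e : R) :
  (supnorm_on N I u <= e%:E)%E <-> forall t, I t -> N (u t) <= e.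
Proof.
split=> [ue t It|ue].
  rewrite -lee_fin; apply: le_trans ue; apply: ereal_sup_ubound.
  by exists t.
by apply: ge_ereal_sup => _ [t It <-]; rewrite lee_fin; exact: ue.
Qed.

(** An approximate solution [y] is pulled back to [P^-1 (y - p)], whose defect grows by at most
    [d2]; stability gives a nearby exact solution [x], and [P x + p] is then close to [y] up to a
    further factor [d1]. *)
Lemma ulam_stable_gauge (R : realType) (n : nat) (N : 'cV[Cplx R]_n -> R)
    (I : set R) (P P' B1 B2 : R -> 'M[Cplx R]_n)
    (p p' g1 g2 : R -> 'cV[Cplx R]_n) :
  is_vnorm N -> C1_on I P P' -> C1_on I p p' ->
  (forall t, I t -> P t \in unitmx) ->
  mxnorm_bounded_on N I P -> mxnorm_bounded_on N I (fun t => invmx (P t)) ->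
  (forall t, I t -> P' t + P t *m B1 t = B2 t *m P t) ->
  (forall t, I t -> P t *m g1 t + p' t - B2 t *m p t = g2 t) ->
  ulam_stable N I B1 g1 -> ulam_stable N I B2 g2.
Proof.
move=> vN C1P C1p uP [c1 P_le] [c2 V_le] PB Pg [K K0 stable].
have N_ge0 : forall x, 0 <= N x by case: vN.
(* The given bounds may fail to be positive, for instance when [n = 0] or [I] is empty, while a
   stability constant must be. *)
pose d1 := Num.max c1 1; pose d2 := Num.max c2 1.
have d1_gt0 : 0 < d1 by rewrite lt_max ltr01 orbT.
have d2_gt0 : 0 < d2 by rewrite lt_max ltr01 orbT.
have NP t x : I t -> N (P t *m x) <= d1 * N x.
  move=> It; apply: le_trans (mxnorm_le x vN (P_le t It)) _.
  by rewrite ler_wpM2r// le_max lexx.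
have NV t x : I t -> N (invmx (P t) *m x) <= d2 * N x.
  move=> It; apply: le_trans (mxnorm_le x vN (V_le t It)) _.
  by rewrite ler_wpM2r// le_max lexx.
exists (d1 * (K * d2)); first by rewrite !mulr_gt0.
move=> eps eps0 y y' C1y /supnorm_on_leP defect.
have C1phi := C1_onM (C1_on_invmx uP C1P) (C1_onD C1y (C1_onN C1p)).
have [|x sol_x /supnorm_on_leP x_near] :=
    stable (d2 * eps) (mulr_gt0 d2_gt0 eps0) _ _ C1phi.
  apply/supnorm_on_leP => t It.
  rewrite (gauge_defect_eq _ _ (uP t It) (PB t It) (Pg t It)).
  by apply: le_trans (NV t _ It) _; rewrite ler_pM2l//; exact: defect.
exists (fun t => P t *m x t + p t) => [t It|].
  rewrite -(gauge_solution_eq _ (PB t It) (Pg t It)).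
  exact: (has_deriv_onD (has_deriv_onM (C1P.1 t It) (sol_x t It)) (C1p.1 t It)).
apply/supnorm_on_leP => t It.
have -> : y t - (P t *m x t + p t) =
    P t *m (invmx (P t) *m (y t - p t) - x t).
  by rewrite mulmxBr mulmxA mulmxV ?uP// mul1mx opprD addrA addrAC.
apply: le_trans (NP t _ It) _; rewrite -!mulrA ler_pM2l//.
exact: x_near.
Qed.

Unset Implicit Arguments.

Theorem theorem2p4 (R : realType) (n : nat) (N : 'cV[Cplx R]_n -> R)
    (N_norm : is_vnorm N) (I : set R) (I_itv : is_interval I)
    (A : R -> 'M[Cplx R]_n) (f : R -> 'cV[Cplx R]_n) (Q Q' : R -> 'M[Cplx R]_n)
    (A_cont : {within I, continuous A})
    (f_cont : {within I, continuous f})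
    (Q_C1 : C1_on I Q Q')
    (Q_unit : forall t, I t -> Q t \in unitmx)
    (Q_bounded : mxnorm_bounded_on N I Q)
    (Qinv_bounded : mxnorm_bounded_on N I (fun t => invmx (Q t))) :
  let J := fun t => (Q' t + Q t *m A t) *m invmx (Q t) in
  ulam_stable N I A f <-> ulam_stable N I J (fun=> 0).
Proof.
move=> J; have [x0 sol_x0] := linear_solution_exists I_itv A_cont f_cont.
have C1x0 : C1_on I x0 (fun t => A t *m x0 t + f t).
  split; first exact: sol_x0.
  exact: (within_continuousD (within_continuous_mulmx A_cont
    (has_deriv_on_continuous sol_x0)) f_cont).
have JQ t : I t -> J t *m Q t = Q' t + Q t *m A t.
  by move=> It; rewrite /J mulmxKV// Q_unit.
split.
(* Here [P = Q] and [p = - Q x0], that is [y = Q (x - x0)]. *)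
- apply: (ulam_stable_gauge N_norm Q_C1 (C1_onN (C1_onM Q_C1 C1x0)) Q_unit
    Q_bounded Qinv_bounded) => t It; first by rewrite JQ.
  rewrite mulmxN mulmxA JQ// mulmxDr mulmxDl opprK !mulmxA.
  rewrite [_ + (_ + Q t *m f t)]addrA opprD [X in X + _]addrCA subrr.
  by rewrite addr0 addNr.
- have Qinv_unit t : I t -> invmx (Q t) \in unitmx.
    by move=> It; rewrite unitmx_inv Q_unit.
  have Qinvinv_bounded : mxnorm_bounded_on N I (fun t => invmx (invmx (Q t))).
    by case: Q_bounded => c Qc; exists c => t It; rewrite invmxK; exact: Qc.
  (* The inverse change of variables [x = Q^-1 y + x0]: [P = Q^-1] and [p = x0]. *)
  apply: (ulam_stable_gauge N_norm (C1_on_invmx Q_unit Q_C1) C1x0 Qinv_unit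
    Qinv_bounded Qinvinv_bounded) => t It.
    rewrite /J mulmxDl mulmxDr !mulmxA addrA addNr add0r.
    by rewrite mulVmx ?Q_unit// mul1mx.
  by rewrite mulmx0 add0r addrC addKr.
Qed.
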